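(* Let $\mathcal{X}$ be a finite alphabet with $|\mathcal{X}|\ge 2$, and consider the Ising channel with alphabet $\mathcal{X}$ (defined in the context), used with noiseless causal output feedback. There exists a feedback coding scheme for this channel that achieves the rate $$R(\mathcal{X}) = \max_{p \in [0,1]} 2\,\frac{H_2(p) + (1-p) \log_2\left(|\mathcal{X}|-1\right)}{p+3}.$$
   Context: The Ising channel with alphabet $\mathcal{X}$ is a finite-state channel with input $X_t\in\mathcal{X}$, output $Y_t\in\mathcal{X}$ and state $S_{t-1}\in\mathcal{X}$. At each time $t$, given the current input $x_t$, the state $s_{t-1}$ and all the past, the output is $Y_t=x_t$ with probability $1/2$ and $Y_t=s_{t-1}$ with probability $1/2$, independently of everything else. The state then updates as $S_t=X_t$. The initial state $s_0$ is known to both encoder and decoder. With feedback, the encoder chooses $x_t$ as a function of the message and the past outputs $y^{t-1}$. A rate is achievable if there exist feedback codes at that rate, in bits per channel use, with error probability tending to zero. $H_2(p)=-p\log_2 p-(1-p)\log_2(1-p)$ is the binary entropy function. *)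

(* Defs.v *)
From HB Require Import structures.
From mathcomp Require Import all_boot all_order all_algebra.
From mathcomp Require Import all_classical all_reals all_analysis.
Set Implicit Arguments. Unset Strict Implicit. Unset Printing Implicit Defensive.
Import Order.TTheory GRing.Theory Num.Theory.
Local Open Scope ring_scope.
Local Open Scope classical_set_scope.

Section Ising.
Variable R : realType.

Definition log2 (x : R) : R := ln x / ln 2.

Definition xlog2 (x : R) : R := if x == 0 then 0 else x * log2 x.

Definition H2 (p : R) : R := - xlog2 p - xlog2 (1 - p).

Variable X : finType.

(* Ising channel law: W(y | x, s) = 1/2 [y = x] + 1/2 [y = s],
   x = current input, s = previous state (= previous input). *)
Definition ising_W (y x s : X) : R :=
  (if y == x then 2^-1 else 0) + (if y == s then 2^-1 else 0).

(* Probability of the remaining outputs [ys], given the feedback encoder [enc]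
   (next input as function of all past outputs), current state [s], and the
   outputs [past] already observed.  The state is updated to the input. *)
Fixpoint ising_prob (enc : seq X -> X) (s : X) (past ys : seq X) : R :=
  match ys with
  | [::] => 1
  | y :: ys' =>
      let x := enc past in ising_W y x s * ising_prob enc x (rcons past y) ys'
  end.

(* Average error probability of a feedback code with block length n,
   M messages, encoder enc (x_t = enc m (y_1..y_{t-1})) and decoder dec,
   used from initial state s0, messages uniformly distributed. *)
Definition fb_error (n M : nat) (enc : 'I_M -> seq X -> X)
    (dec : n.-tuple X -> 'I_M) (s0 : X) : R :=
  M%:R^-1 * \sum_(m < M) \sum_(y : n.-tuple X | dec y != m)
                              ising_prob (enc m) s0 [::] y.

Definition fb_achievable (s0 : X) (Rt : R) : Prop :=
  forall eps : R, 0 < eps ->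
  exists N : nat, forall n : nat, (N <= n)%N ->
  exists (M : nat) (enc : 'I_M -> seq X -> X) (dec : n.-tuple X -> 'I_M),
    (0 < M)%N /\ n%:R * (Rt - eps) <= log2 M%:R /\ fb_error enc dec s0 <= eps.

Definition ising_obj (p : R) : R :=
  2 * (H2 p + (1 - p) * log2 (#|X|.-1)%:R) / (p + 3).

Definition ising_rate : R := sup [set ising_obj p | p in `[0, 1]%classic].

End Ising.

(* Main.v *)
(* To convey a symbol [a] when the decoder knows the channel state [s], send
   [a]; if the output is [s] the decoder is in doubt, and [a] is sent again: the
   state is now [a] as well, so this second output is [a] for certain.  A symbol
   equal to [s] thus takes 2 uses, any other one 3/2 uses on average.
   As in Shannon's noiseless channel with symbol costs, the best rate [R0] is
   [- 2 log2 u] where [u ^ 4 + (|X| - 1) u ^ 3 = 1], the exponents being twice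
   these costs: Gibbs' inequality bounds the objective by [R0] at every [p], and
   the recursion defining the words of total doubled cost about [T] shows that
   there are at least [u ^ (3 - T)] of them.  Since
   [((1 + x) + (1 + x) ^ 2) / 2 <= expR (3 x / 2)], an exponential Markov bound
   makes the probability of needing more than [n] uses exponentially small as
   soon as [T / 2 <= n (1 - d)]. *)
Require Import Defs.
From HB Require Import structures.
From mathcomp Require Import all_boot all_order all_algebra.
From mathcomp Require Import all_classical all_reals all_analysis.
From mathcomp Require Import ring lra zify.
Set Implicit Arguments. Unset Strict Implicit.
Import Order.TTheory GRing.Theory Num.Theory.
Local Open Scope ring_scope.

(* [T] is a budget of doubled costs: repeating [s] costs 4, a change costs 3, and a
   word ends once the remaining budget is below 4. *)
Fixpoint words {X : finType} (T : nat) (s : X) : seq (seq X) :=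
  match T with
  | ((((t.+1) as u).+1).+1).+1 =>
      [seq s :: w | w <- words t s]
        ++ flatten [seq [seq a :: w | w <- words u a] | a <- enum (predC1 s)]
  | _ => [:: [::]]
  end.

(* The next channel input, given the known state [s], the symbols [v] still to be
   conveyed and the outputs [past] observed since [s] became known. *)
Fixpoint encode {X : eqType} (s : X) (v past : seq X) : X :=
  match v, past with
  | [::], _ => s
  | a :: _, [::] => a
  | a :: v', y :: past' =>
      if y != s then encode a v' past'
      else if past' is _ :: past'' then encode a v' past'' else a
  end.

(** No word length is given: once a word has been conveyed, parsing goes on and appends meaningless
    symbols, so only a prefix of the result carries information. *)
Fixpoint parse {X : eqType} (s : X) (ys : seq X) : seq X :=
  match ys with
  | [::] => [::]
  | y :: ys' =>
      if y != s then y :: parse y ys'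
      else if ys' is z :: ys'' then z :: parse z ys'' else [::]
  end.

(* The probability that [n] uses do not suffice to convey [v]. *)
Definition failure (R : realType) {X : finType} (n : nat) (s : X) (v : seq X) : R :=
  \sum_(y : n.-tuple X)
     (~~ prefix v (parse s y))%:R * ising_prob R (encode s v) s [::] y.

(** * Words within a budget: prefix-freeness and counting *)

Lemma ind34 (P : nat -> Prop) :
  (forall T, (T < 4)%N -> P T) -> (forall t, P t -> P t.+1 -> P t.+4) ->
  forall T, P T.
Proof.
move=> P0 PS T; elim/ltn_ind: T => -[|[|[|[|t]]]] IH; try exact: P0.
by apply: PS; apply: IH; lia.
Qed.

Lemma words_small {X : finType} (T : nat) (s : X) :
  (T < 4)%N -> words T s = [:: [::]].
Proof. by case: T => [|[|[|[|T]]]]. Qed.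

Lemma words4 {X : finType} (t : nat) (s : X) :
  words t.+4 s = [seq s :: w | w <- words t s]
    ++ flatten [seq [seq a :: w | w <- words t.+1 a] | a <- enum (predC1 s)].
Proof. by []. Qed.

Lemma mem_words4 {X : finType} (t : nat) (s : X) (v : seq X) :
  v \in words t.+4 s ->
  exists a w, v = a :: w /\ w \in words (if a == s then t else t.+1) a.
Proof.
rewrite words4 mem_cat => /orP[/mapP[w hw ->]|/flattenP[l /mapP[a ha ->]]].
  by exists s, w; rewrite eqxx.
case/mapP=> w hw ->; exists a, w; move: ha.
by rewrite mem_enum inE => /negbTE ->.
Qed.

(** This makes decoding unambiguous although [parse] runs past the end of the word. Equal first
    symbols leave equal budgets, so the induction applies to the tails. *)
Lemma words_prefix_free {X : finType} (T : nat) (s : X) :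
  {in words T s &, forall v w, prefix v w -> v = w}.
Proof.
elim/ind34: T s => [T hT s v w|t IH0 IH1 s v w].
  by rewrite words_small // !inE => /eqP-> /eqP->.
move=> /mem_words4[a [v' [-> hv]]] /mem_words4[b [w' [-> hw]]].
rewrite prefix_cons => /andP[/eqP ab]; subst b.
by move: hv hw; case: ifP => _ hv hw hp; congr cons;
  [exact: (IH0 a)|exact: (IH1 a)].
Qed.

Lemma words_uniq {X : finType} (T : nat) (s : X) : uniq (words T s).
Proof.
elim/ind34: T s => [T hT s|t IH0 IH1 s]; first by rewrite words_small.
have cons_inj (a : X) : injective (cons a) by move=> ? ? [].
rewrite words4 cat_uniq (map_inj_uniq (cons_inj s)) IH0 /=.
apply/andP; split.
  apply/hasPn => v /flattenP[l /mapP[a + ->] /mapP[w _ ->]].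
  rewrite mem_enum inE => ha; apply/negP => /mapP[w' _ [e]].
  by rewrite e eqxx in ha.
elim: (enum _) (enum_uniq (predC1 s)) => //= a l IHl /andP[al ul].
rewrite cat_uniq (map_inj_uniq (cons_inj a)) IH1 IHl // andbT /=.
apply/hasPn => v /flattenP[l' /mapP[b bl ->] /mapP[w _ ->]].
by apply/negP => /mapP[w' _ [e]]; rewrite -e bl in al.
Qed.

(** The factors [u ^+ 4] (one repetition) and [u ^+ 3] (each of the [#|X|.-1] changes) sum to 1, so
    the bound passes through the recursion as through an average. At the leaves [T <= 3] and
    [u <= 1]. *)
Lemma size_words_lb (R : realType) {X : finType} (u : R) (T : nat) (s : X) :
  0 < u <= 1 -> u ^+ 4 + #|X|.-1%:R * u ^+ 3 = 1 ->
  u ^+ 3 <= u ^+ T * (size (words T s))%:R.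
Proof.
move=> /andP[u0 u1] hu; elim/ind34: T s => [T hT s|t IH0 IH1 s].
  by rewrite words_small // mulr1; apply: ler_wiXn2l => //; exact: ltW.
rewrite words4 size_cat size_map size_flatten /shape -map_comp sumnE.
rewrite big_map big_enum /= natrD natr_sum mulrDr mulr_sumr.
rewrite -[leLHS]mul1r -[k in k * _ <= _]hu mulrDl; apply: lerD.
  rewrite (exprD u 4 t) -mulrA; apply: ler_wpM2l (IH0 s).
  by rewrite exprn_ge0 // ltW.
have -> : #|X|.-1%:R * u ^+ 3 * u ^+ 3 = \sum_(a | predC1 s a) u ^+ 3 * u ^+ 3.
  rewrite sumr_const -mulrA mulr_natl; congr (_ *+ _).
  by rewrite cardC1.
apply: ler_sum => a _; rewrite size_map (exprD u 3 t.+1) -mulrA.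
by apply: ler_wpM2l (IH1 a); rewrite exprn_ge0 // ltW.
Qed.

(** * Recursion for the failure probability *)

Lemma sum_ising_W (R : realType) {X : finType} (a s : X) (G : X -> R) :
  \sum_y ising_W R y a s * G y = 2^-1 * G a + 2^-1 * G s.
Proof.
under eq_bigr do rewrite /ising_W mulrDl.
rewrite big_split /=; congr (_ + _).
  rewrite (bigD1 a) //= eqxx big1 ?addr0 // => i /negbTE ->; exact: mul0r.
rewrite (bigD1 s) //= eqxx big1 ?addr0 // => i /negbTE ->; exact: mul0r.
Qed.

Lemma sum_tuple0 (R : realType) {X : finType} (F : seq X -> R) :
  \sum_(y : 0.-tuple X) F y = F [::].
Proof.
rewrite (bigD1 [tuple]) //= big1 ?addr0 // => y.
by rewrite (tuple0 y) => /eqP.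
Qed.

Lemma sum_tupleS (R : realType) {X : finType} n (F : seq X -> R) :
  \sum_(y : n.+1.-tuple X) F y = \sum_a \sum_(y : n.-tuple X) F (a :: y).
Proof.
rewrite pair_big /=.
rewrite (reindex (fun p : X * n.-tuple X => [tuple of p.1 :: p.2])) //=.
exists (fun y : n.+1.-tuple X => (thead y, [tuple of behead y])).
  by move=> [a y] _; congr (_, _); apply: val_inj.
by move=> y _; rewrite -tuple_eta.
Qed.

Lemma ising_prob_shift (R : realType) {X : finType} (enc enc' : seq X -> X)
    (s : X) (past past' ys : seq X) :
  (forall q, enc (past ++ q) = enc' (past' ++ q)) ->
  ising_prob R enc s past ys = ising_prob R enc' s past' ys.
Proof.
elim: ys s past past' => //= y ys IH s past past' H.
have := H [::]; rewrite !cats0 => ->; congr (_ * _).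
by apply: IH => q; rewrite !cat_rcons H.
Qed.

Lemma failure_nil (R : realType) {X : finType} n (s : X) :
  failure R n s [::] = 0.
Proof. by rewrite /failure big1 // => y _; rewrite prefix0s mul0r. Qed.

Lemma failure_cons0 (R : realType) {X : finType} (s a : X) v :
  failure R 0 s (a :: v) = 1.
Proof.
rewrite /failure (sum_tuple0 (fun y => (~~ prefix (a :: v) (parse s y))%:R
  * ising_prob R (encode s (a :: v)) s [::] y)).
by rewrite /= mulr1.
Qed.

(** Condition on the first output, [a] or [s] with probability 1/2 each. Output [s] costs a second
    use, whence [resent], which is 1 if no use is left; for [a = s] this always happens. *)
Lemma failure_consS (R : realType) {X : finType} n (s a : X) v :
  let resent := if n is n'.+1 then failure R n' a v else 1 in
  failure R n.+1 s (a :: v) =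
    if a == s then resent else 2^-1 * failure R n a v + 2^-1 * resent.
Proof.
move=> resent.
pose G (b : X) := \sum_(y : n.-tuple X) (~~ prefix (a :: v) (parse s (b :: y)))%:R
   * ising_prob R (fun q => encode s (a :: v) (b :: q)) a [::] y.
have -> : failure R n.+1 s (a :: v) = 2^-1 * G a + 2^-1 * G s.
  rewrite -sum_ising_W /failure.
  rewrite (sum_tupleS n (fun y => (~~ prefix (a :: v) (parse s y))%:R
    * ising_prob R (encode s (a :: v)) s [::] y)); apply: eq_bigr => b _.
  rewrite mulr_sumr; apply: eq_bigr => y _.
  rewrite mulrCA; congr (_ * (_ * _)).
  exact: ising_prob_shift.
have Gs : G s = resent.
  pose F y := (~~ prefix (a :: v) (parse s (s :: y)))%:R
    * ising_prob R (fun q => encode s (a :: v) (s :: q)) a [::] y.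
  rewrite /G /resent; case: n {G resent} => [|n].
    by rewrite (sum_tuple0 F) /F /= eqxx /= mulr1.
  rewrite (sum_tupleS n F).
  under eq_bigr => b _.
    under eq_bigr do rewrite /F /= eqxx /= mulrCA.
    rewrite -mulr_sumr; over.
  (* On the second use input and state are both [a], so the two halves of the law merge into a sure
     output [a]. *)
  rewrite sum_ising_W -mulrDl (_ : 2^-1 + 2^-1 = 1) ?mul1r; last lra.
  apply: eq_bigr => y _; rewrite eqxx; congr (_ * _).
  exact: ising_prob_shift.
rewrite Gs; case: eqVneq => [e|nas].
  rewrite {1}e Gs; lra.
congr (_ * _ + _); apply: eq_bigr => y _.
by rewrite /= nas prefix_cons eqxx.
Qed.

(** * Exponential Markov bound on the number of uses *)

Lemma failure_bound (R : realType) {X : finType} (x : R) (T n : nat) (s : X) v :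
  0 <= x -> v \in words T s ->
  failure R n s v * (1 + x) ^+ n <= expR (x / 2) ^+ T.
Proof.
move=> x0.
set g := expR (x / 2).
have g1 : 1 <= g by apply: le_trans (expR_ge1Dx _); rewrite lerDl divr_ge0.
have h1 : 1 + x / 2 <= g by exact: expR_ge1Dx.
have h2 : 1 + x <= g ^+ 2.
  by rewrite /g -expRM_natl mulrC divfK //; exact: expR_ge1Dx.
have h3 : (1 + x) * (1 + x / 2) <= g ^+ 3.
  rewrite (exprD g 2 1); apply: ler_pM => //; lra.
have h4 : (1 + x) ^+ 2 <= g ^+ 4.
  by rewrite (exprM g 2 2); apply: lerXn2r => //; rewrite nnegrE; lra.
have z0 : 0 <= 1 + x by lra.
have z1 : 1 <= 1 + x by lra.
elim/ind34: T n s v => [T hT n s v|T IH0 IH1 n s v].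
  rewrite words_small // inE => /eqP ->.
  by rewrite failure_nil mul0r exprn_ge0 // (le_trans _ g1).
move=> /mem_words4[a [w [-> hw]]].
case: n => [|n].
  by rewrite failure_cons0 expr0 mulr1 exprn_ege1.
rewrite failure_consS.
set resent := (match n with 0%N => _ | _ => _ end).
have gk k : 1 <= g ^+ k by exact: exprn_ege1.
have resent_le k : (forall m, failure R m a w * (1 + x) ^+ m <= g ^+ k) ->
    resent * (1 + x) ^+ n.+1 <= (1 + x) ^+ 2 * g ^+ k.
  rewrite /resent; case: (n) => [_|m H].
    rewrite mul1r expr1 expr2 -mulrA ler_peMr // mulr_ege1 //.
  have -> : failure R m a w * (1 + x) ^+ m.+2 =
     (1 + x) ^+ 2 * (failure R m a w * (1 + x) ^+ m) by rewrite (exprD _ 2 m); ring.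
  by apply: ler_wpM2l => //; rewrite exprn_ge0.
case: ifP hw => [as_|_] hw.
  apply: (le_trans (resent_le T _)) => [m|]; first exact: IH0.
  by rewrite (exprD g 4 T) ler_wpM2r // (le_trans _ (gk _)).
have hm m : failure R m a w * (1 + x) ^+ m <= g ^+ T.+1 by exact: IH1.
have := resent_le _ hm; have := hm n; rewrite (exprD g 3 T.+1).
rewrite [(1 + x) ^+ n.+1]exprS => H1 H2.
(* A change takes one or two uses with equal odds: the mean of [1 + x] and [(1 + x) ^+ 2] is
   [(1 + x) * (1 + x / 2)]. *)
apply: (@le_trans _ _ ((1 + x) * (1 + x / 2) * g ^+ T.+1)); last first.
  by rewrite ler_wpM2r // (le_trans _ (gk _)).
have H3 := ler_wpM2l z0 H1; move: H2 H3; rewrite expr2.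
set A := (1 + x) ^+ n; set B := g ^+ _; set F := failure _ _ _ _; nra.
Qed.

(** * The root [u] and Gibbs' inequality *)

Lemma exists_base (R : realType) (k : nat) : (0 < k)%N ->
  exists2 u : R, 0 < u <= 1 & u ^+ 4 + k%:R * u ^+ 3 = 1.
Proof.
move=> k0; pose p : {poly R} := 'X^4 + k%:R%:P * 'X^3 - 1.
have pE x : p.[x] = x ^+ 4 + k%:R * x ^+ 3 - 1.
  by rewrite /p !hornerE.
have [|u /andP[u0 u1] /rootP] := @poly_ivt R p 0 1 ler01.
  have k1 : 0 <= k%:R :> R by [].
  by rewrite !pE !expr0n !expr1n /=; apply/andP; split; lra.
rewrite pE => /subr0_eq hu; exists u => //; rewrite u1 lt_neqAle u0 !andbT.
by apply: contra_eq_neq hu => <-; rewrite !expr0n /= mulr0 addr0 eq_sym oner_neq0.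
Qed.

(** One term of Gibbs' inequality: [ln t <= t - 1] at [t = b / a], multiplied by [a]. *)
Lemma xlog2_gibbs (R : realType) (a b : R) : 0 <= a -> 0 < b ->
  - xlog2 a + a * log2 b <= (b - a) / ln 2.
Proof.
move=> a0 b0; have l2 : 0 < ln (2 : R) by rewrite ln_gt0 // ltr1n.
rewrite /xlog2; case: eqVneq a0 => [-> _|an0 a0].
  by rewrite oppr0 mul0r !addr0 divr_ge0 // ltW.
have {an0}a0 : 0 < a by rewrite lt_def an0.
rewrite /log2 !mulrA -mulNr -mulrDl ler_pM2r ?invr_gt0 //.
have ba : 0 < b / a by rewrite divr_gt0.
have : ln (1 + (b / a - 1)) <= b / a - 1 by apply: le_ln1Dx; lra.
rewrite addrC subrK ln_div ?posrE // => /(ler_wpM2l (ltW a0)).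
rewrite !mulrBr mulrCA divff ?gt_eqF // !mulr1; lra.
Qed.

(** Compare [(p, 1 - p)] with [(u ^+ 4, #|X|.-1%:R * u ^+ 3)]. Both sum to 1, so the right sides of
    the two Gibbs terms cancel; the coefficient of [log2 u] is [4 p + 3 (1 - p) = p + 3], the
    denominator of the objective. *)
Lemma ising_obj_le (R : realType) (X : finType) (u p : R) :
  (2 <= #|X|)%N -> 0 < u -> u ^+ 4 + #|X|.-1%:R * u ^+ 3 = 1 -> 0 <= p <= 1 ->
  ising_obj X p <= - 2 * log2 u.
Proof.
move=> hX u0 hu /andP[p0 p1].
have k0 : 0 < #|X|.-1%:R :> R by rewrite ltr0n -ltnS prednK // (leq_trans _ hX).
have u3 : 0 < u ^+ 3 by rewrite exprn_gt0.
have u4 : 0 < u ^+ 4 by rewrite exprn_gt0.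
have G1 := xlog2_gibbs p0 u4.
have G2 := @xlog2_gibbs R (1 - p) (#|X|.-1%:R * u ^+ 3) ltac:(lra) (mulr_gt0 k0 u3).
have E4 : log2 (u ^+ 4) = 4 * log2 u.
  by rewrite /log2 lnXn // -[ln u *+ 4]mulr_natl mulrA.
have E3 : log2 (#|X|.-1%:R * u ^+ 3) = log2 #|X|.-1%:R + 3 * log2 u.
  by rewrite /log2 lnM ?posrE // lnXn // mulrDl -[ln u *+ 3]mulr_natl mulrA.
have S0 : (u ^+ 4 - p) / ln 2 + (#|X|.-1%:R * u ^+ 3 - (1 - p)) / ln 2 = 0.
  rewrite -mulrDl [k in k * _](_ : _ = 0) ?mul0r //; lra.
rewrite /ising_obj ler_pdivrMr; last lra.
rewrite /H2; move: G1 G2 S0; rewrite E4 E3.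
set A := xlog2 p; set B := xlog2 _; set L := log2 u; set Q := log2 _.
set V := _ / _; set W := _ / _; nra.
Qed.

Lemma ising_rate_le (R : realType) (X : finType) (u : R) :
  (2 <= #|X|)%N -> 0 < u -> u ^+ 4 + #|X|.-1%:R * u ^+ 3 = 1 ->
  ising_rate R X <= - 2 * log2 u.
Proof.
move=> hX u0 hu; apply: ge_sup.
  by exists (ising_obj X (0 : R)), 0 => //=; rewrite in_itv /= lexx ler01.
move=> _ [p + <-]; rewrite /= in_itv /=; exact: ising_obj_le.
Qed.

(** * From words to a feedback code, and its error exponent *)

Lemma ising_prob_ge0 (R : realType) (X : finType) (enc : seq X -> X) s past ys :
  0 <= ising_prob R enc s past ys.
Proof.
elim: ys s past => //= y ys IH s past; apply: mulr_ge0 => //.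
by rewrite /ising_W; apply: addr_ge0; case: ifP.
Qed.

Lemma fb_error_words (R : realType) (X : finType) (T n : nat) (s : X) (e : R) :
  (forall v, v \in words T s -> failure R n s v <= e) -> (0 < size (words T s))%N ->
  exists (enc : 'I_(size (words T s)) -> seq X -> X)
         (dec : n.-tuple X -> 'I_(size (words T s))),
    fb_error R enc dec s <= e.
Proof.
set W := words T s => he W0.
pose w (m : 'I_(size W)) := nth [::] W m.
have wW m : w m \in W by exact: mem_nth.
exists (fun m => encode s (w m)).
(* The default message is reached only if no word is a prefix of the parsed output, which counts as
   failure for every message. *)
pose dec (y : n.-tuple X) :=
  odflt (Ordinal W0) [pick m | prefix (w m) (parse s y)].
exists dec.
have decP (y : n.-tuple X) m : prefix (w m) (parse s y) -> dec y = m.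
  rewrite /dec => pm; case: pickP => [m' /= pm'|/(_ m)]; last by rewrite pm.
  have ww : w m' = w m.
    (* Two prefixes of one sequence are comparable, hence equal here by prefix-freeness. *)
    case/orP: (leq_total (size (w m')) (size (w m))) => le.
      apply: (words_prefix_free (wW _) (wW _)).
      by move: pm pm'; rewrite !prefixE => /eqP <-; rewrite take_takel.
    apply/esym/(words_prefix_free (wW _) (wW _)).
    by move: pm pm'; rewrite !prefixE => + /eqP <-; rewrite take_takel.
  apply: val_inj; apply/eqP => /=.
  rewrite -(nth_uniq [::] (ltn_ord m') (ltn_ord m) (words_uniq T s)).
  exact/eqP.
rewrite /fb_error ler_pdivrMl ?ltr0n // mulr_natl.
rewrite -[X in _ *+ X]card_ord -sumr_const; apply: ler_sum => m _.
apply: le_trans (he _ (wW m)).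
rewrite big_mkcond; apply: ler_sum => y _.
case: ifP => [dm|_]; last by rewrite mulr_ge0 ?ising_prob_ge0.
rewrite (_ : prefix _ _ = false) ?mul1r //.
by apply/negP => /decP e'; rewrite e' eqxx in dm.
Qed.

(** With [x = d / 2], the exponent is at most [n x (1 - d) - n x / (1 + x) <= n x (x - d)], using
    [1 / (1 + x) >= 1 - x]; this choice of [x] minimises [x (x - d)]. *)
Lemma expR_delay_le (R : realType) (d : R) (T n : nat) : 0 < d <= 1 ->
  T%:R <= 2 * n%:R * (1 - d) ->
  expR (d / 2 / 2) ^+ T <= expR (- (n%:R * d ^+ 2 / 4)) * (1 + d / 2) ^+ n.
Proof.
move=> /andP[d0 d1] hT.
have x0 : 0 < 1 + d / 2 by lra.
rewrite -ler_pdivrMr ?exprn_gt0 //.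
have h : (1 + d / 2)^-1 <= expR (- (d / 2) / (1 + d / 2)).
  rewrite [leLHS](_ : _ = 1 + - (d / 2) / (1 + d / 2)); first exact: expR_ge1Dx.
  by field; lra.
rewrite -exprVn -expRM_natl.
apply: (@le_trans _ _ (expR (T%:R * (d / 2 / 2)) *
   expR (n%:R * (- (d / 2) / (1 + d / 2))))).
  rewrite expRM_natl [in leRHS]expRM_natl.
  by apply: ler_wpM2l; [rewrite exprn_ge0 ?expR_ge0|
    apply: lerXn2r; rewrite // nnegrE ?expR_ge0 // invr_ge0 ltW].
rewrite -expRD ler_expR.
have hi : 1 - d / 2 <= (1 + d / 2)^-1.
  by rewrite -[leRHS]div1r ler_pdivlMr //; nra.
have n0 : 0 <= n%:R :> R by [].
have h1 : T%:R * (d / 2 / 2) <= 2 * n%:R * (1 - d) * (d / 2 / 2).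
  by apply: ler_wpM2r => //; lra.
have nd : 0 <= n%:R * (d / 2) by apply: mulr_ge0 => //; lra.
have h2 := ler_wpM2l nd hi.
move: h1 h2; rewrite expr2; set I := (1 + d / 2)^-1; lra.
Qed.

Lemma failure_le_expR (R : realType) (X : finType) (d : R) (T n : nat) (s : X) v :
  0 < d <= 1 -> T%:R <= 2 * n%:R * (1 - d) -> v \in words T s ->
  failure R n s v <= expR (- (n%:R * d ^+ 2 / 4)).
Proof.
move=> d01 hT hv; have /andP[d0 _] := d01.
have x0 : 0 <= d / 2 by lra.
have := le_trans (failure_bound n x0 hv) (expR_delay_le d01 hT).
by rewrite ler_pM2r // exprn_gt0 // ltr_wpDr.
Qed.

Theorem theorem4 (R : realType) (X : finType) (hX : (2 <= #|X|)%N) (s0 : X) :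
  fb_achievable s0 (ising_rate R X).
Proof.
move=> eps eps0.
have [|u /andP[u0 u1] hu] := @exists_base R #|X|.-1.
  by rewrite -ltnS prednK // (leq_trans _ hX).
have l2 : 0 < ln (2 : R) by rewrite ln_gt0 // ltr1n.
set R0 := - 2 * log2 u.
have R00 : 0 <= R0.
  rewrite /R0 mulNr oppr_ge0 pmulr_rle0 // /log2 pmulr_lle0 ?invr_gt0 //.
  exact: ln_le0.
have hL : log2 u = - (R0 / 2) by rewrite /R0; lra.
have rate_le : ising_rate R X <= R0 by exact: ising_rate_le.
(* Chosen so that the rate lost to the slack, [d * R0], is at most [eps / 2]; the added [eps] covers
   [R0 = 0] and keeps [d <= 1]. *)
pose d := eps / (2 * (R0 + eps)).
have d0 : 0 < d by rewrite divr_gt0 // mulr_gt0 // ltr_wpDl.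
have dE : d * (R0 + eps) = eps / 2.
  by rewrite /d; field; lra.
clearbody R0 d.
have d1 : d <= 1 by nra.
have d20 : 0 < d ^+ 2 / 4 by rewrite divr_gt0 // exprn_gt0.
(* The first bound absorbs a constant loss of [2 * R0] bits; the second gives
   [expR (n d^2 / 4) >= 1 / eps]. *)
exists (maxn (Num.truncn (4 * R0 / eps)).+1
             (Num.truncn ((eps * (d ^+ 2 / 4))^-1)).+1) => n.
rewrite geq_max => /andP[n1 n2].
have {}n1 : 4 * R0 / eps <= n%:R.
  apply: ltW; rewrite -truncn_lt_nat //.
  exact: divr_ge0 (mulr_ge0 (ler0n _ 4) R00) (ltW eps0).
have {}n2 : (eps * (d ^+ 2 / 4))^-1 <= n%:R.
  apply: ltW; rewrite -truncn_lt_nat // invr_ge0.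
  exact: mulr_ge0 (ltW eps0) (ltW d20).
have n0 : 0 <= n%:R :> R by [].
have B0 : 0 <= 2 * n%:R * (1 - d) by rewrite !mulr_ge0 // subr_ge0.
pose T := Num.truncn (2 * n%:R * (1 - d)).
have /andP[T1 T2] := truncn_itv B0; rewrite -/T in T1 T2; clearbody T.
have sz := size_words_lb T s0 (introT andP (conj u0 u1)) hu.
have M0 : (0 < size (words T s0))%N.
  rewrite lt0n; apply: contraTneq sz => ->.
  by rewrite mulr0 -ltNge exprn_gt0.
have [v hv|enc [dec err]] := @fb_error_words R X T n s0 eps _ M0.
  apply: le_trans (failure_le_expR (introT andP (conj d0 d1)) T1 hv) _.
  rewrite expRN -[leRHS]invrK.
  rewrite lef_pV2 ?posrE ?expR_gt0 ?invr_gt0 //.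
  apply: le_trans (expR_ge1Dx _).
  move: n2; rewrite invfM ler_pdivrMr // -mulrA => n2; lra.
exists (size (words T s0)), enc, dec; split => //; split => //.
have : ln (u ^+ 3) <= ln (u ^+ T * (size (words T s0))%:R).
  by rewrite ler_ln ?posrE ?mulr_gt0 ?exprn_gt0 ?ltr0n.
rewrite lnM ?posrE ?exprn_gt0 ?ltr0n // !lnXn // => sz'.
have hM : 3 * log2 u - T%:R * log2 u <= log2 (size (words T s0))%:R.
  by rewrite /log2 !mulrA -mulrBl ler_pM2r ?invr_gt0 // !mulr_natl; lra.
apply: le_trans hM.
rewrite hL.
(* The code carries at least [(T - 3) R0 / 2] bits and [T > 2 n (1 - d) - 1], hence at least
   [n (1 - d) R0 - 2 R0]; each of the two losses is at most [n eps / 2]. *)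
have n1' : 4 * R0 <= n%:R * eps by rewrite -ler_pdivrMr.
have q1 : n%:R * (ising_rate R X - eps) <= n%:R * (R0 - eps).
  by apply: ler_wpM2l => //; lra.
have q2 : (2 * n%:R * (1 - d) - 1) * R0 <= T%:R * R0.
  by apply: ler_wpM2r => //; move: T2; rewrite -natr1; lra.
have q3 : n%:R * (d * R0) <= n%:R * (eps / 2).
  by apply: ler_wpM2l => //; nra.
lra.
Qed.
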